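(* Let $n\ge1$ be an integer and $\zeta_n$ a primitive $n$-th root of unity. For all integers $k,r,s\ge0$, the sums $\sum_{\mathbf{k}\in I(k,r,s)}\overline{z}_n(\mathbf{k};\zeta_n)$ and $\sum_{\mathbf{k}\in I(k,r,s)}\overline{z}^\star_n(\mathbf{k};\zeta_n)$ are rational numbers. More precisely, as formal power series in $x,y,z$, $$F_n(x,y,z)=U_n(x,y,z),\qquad F_n^\star(x,y,z)=U_n(x,-y,-z)^{-1},$$ where $$U_n(x,y,z)=\frac{x}{(1+x)^n-1}\sum_{\substack{a,b\ge0\\ a+b\le n-1}}\frac{1}{n-a-b}\binom{n-a-1}{b}\binom{n-b-1}{a}(1+x)^a(1+y)^b(xy-z)^{n-1-a-b}.$$
   Context: For an index $\mathbf{k}=(k_1,\dots,k_r)\in(\mathbb{Z}_{\ge1})^r$ define its weight $\mathrm{wt}(\mathbf{k})=k_1+\dots+k_r$, depth $r$, and height $\#\{a\in\{1,\dots,r\}: k_a\ge2\}$; $I(k,r,s)$ is the set of indices of weight $k$, depth $r$ and height $s$. For $q$ a primitive $n$-th root of unity $\zeta_n$ set $$z_n(\mathbf{k};q)=\sum_{n>m_1>\dots>m_r>0}\prod_{i=1}^r\frac{q^{(k_i-1)m_i}}{[m_i]_q^{k_i}},\quad z^\star_n(\mathbf{k};q)=\sum_{n>m_1\ge\dots\ge m_r>0}\prod_{i=1}^r\frac{q^{(k_i-1)m_i}}{[m_i]_q^{k_i}},$$ with $[m]_q=(1-q^m)/(1-q)$, and $\overline{z}_n(\mathbf{k};\zeta_n)=(1-\zeta_n)^{-\mathrm{wt}(\mathbf{k})}z_n(\mathbf{k};\zeta_n)$,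 $\overline{z}^\star_n(\mathbf{k};\zeta_n)=(1-\zeta_n)^{-\mathrm{wt}(\mathbf{k})}z^\star_n(\mathbf{k};\zeta_n)$. Define $$F_n(x,y,z)=1+\sum_{r=1}^\infty\sum_{s=0}^r\sum_{k=r+s}^\infty\Big(\sum_{\mathbf{k}\in I(k,r,s)}\overline{z}_n(\mathbf{k};\zeta_n)\Big)x^{k-r-s}y^{r-s}z^s,$$ and $F_n^\star$ the same with $\overline{z}^\star_n$ in place of $\overline{z}_n$. *)

(* Defs.v *)
From HB Require Import structures.
From mathcomp Require Import all_boot all_order all_algebra.
From mathcomp Require Import boolp.

Set Implicit Arguments.
Unset Strict Implicit.
Unset Printing Implicit Defensive.

Import GRing.Theory.
Local Open Scope ring_scope.

(* A record rather than the bare function type nat -> R, which may carry the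
   pointwise product. *)
Record fps (R : Type) := Fps { fcoef : nat -> R }.

HB.instance Definition _ (R : Type) := gen_eqMixin (fps R).
HB.instance Definition _ (R : Type) := gen_choiceMixin (fps R).

Section FpsRing.
Variable R : idomainType.
Implicit Types a b c : fps R.

Lemma fpsP a b : (forall n, fcoef a n = fcoef b n) <-> a = b.
Proof.
split=> [|-> //]; case: a b => [f] [g] /= fg.
by congr Fps; apply/funext.
Qed.

Definition fps0 : fps R := Fps (fun=> 0).
Definition fps_opp a : fps R := Fps (fun n => - fcoef a n).
Definition fps_add a b : fps R := Fps (fun n => fcoef a n + fcoef b n).

Lemma fps_addA : associative fps_add.
Proof. by move=> a b c; apply/fpsP=> n /=; rewrite addrA. Qed.
Lemma fps_addC : commutative fps_add.
Proof. by move=> a b; apply/fpsP=> n /=; rewrite addrC. Qed.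
Lemma fps_add0 : left_id fps0 fps_add.
Proof. by move=> a; apply/fpsP=> n /=; rewrite add0r. Qed.
Lemma fps_addN : left_inverse fps0 fps_opp fps_add.
Proof. by move=> a; apply/fpsP=> n /=; rewrite addNr. Qed.

HB.instance Definition _ :=
  GRing.isZmodule.Build (fps R) fps_addA fps_addC fps_add0 fps_addN.

Definition fpsC (r : R) : fps R := Fps (fun n => if n == 0%N then r else 0).
Definition fpsX : fps R := Fps (fun n => (n == 1%N)%:R).
Definition fps_mul a b : fps R :=
  Fps (fun n => \sum_(i < n.+1) fcoef a i * fcoef b (n - i)%N).

Let trunc N a : {poly R} := \poly_(i < N.+1) fcoef a i.

Let trunc_coef N a n : (n <= N)%N -> (trunc N a)`_n = fcoef a n.
Proof. by move=> nN; rewrite coef_poly ltnS nN. Qed.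

Let fps_mulE N a b n : (n <= N)%N ->
  fcoef (fps_mul a b) n = (trunc N a * trunc N b)`_n.
Proof.
move=> nN /=; rewrite coefM; apply: eq_bigr => i _.
have iN : (i <= N)%N := leq_trans (leq_ord i) nN.
by rewrite !trunc_coef // (leq_trans (leq_subr _ _)).
Qed.

Lemma fps_mulC : commutative fps_mul.
Proof.
by move=> a b; apply/fpsP=> n; rewrite !(fps_mulE _ _ (leqnn n)) mulrC.
Qed.

Lemma fps_mulA : associative fps_mul.
Proof.
move=> a b c; apply/fpsP=> n.
transitivity (trunc n a * (trunc n b * trunc n c))`_n.
  rewrite coefM; apply: eq_bigr => i _.
  by rewrite (trunc_coef _ (leq_ord i)) (fps_mulE (N := n)) ?leq_subr.
rewrite mulrA coefM; apply: eq_bigr => i _.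
by rewrite (fps_mulE _ _ (leq_ord i)) trunc_coef ?leq_subr.
Qed.

Lemma fps_mul1 : left_id (fpsC 1) fps_mul.
Proof.
move=> a; apply/fpsP=> n /=; rewrite big_ord_recl /= mul1r subn0 big1 ?addr0 //.
by move=> i _; rewrite mul0r.
Qed.

Lemma fps_mulDl : left_distributive fps_mul fps_add.
Proof.
move=> a b c; apply/fpsP=> n /=; rewrite -big_split.
by apply: eq_bigr => i _; rewrite mulrDl.
Qed.

Lemma fps_1neq0 : fpsC 1 != 0 :> fps R.
Proof.
by apply/eqP=> /fpsP /(_ 0%N) /= /eqP; rewrite oner_eq0.
Qed.

HB.instance Definition _ := GRing.Zmodule_isComNzRing.Build (fps R)
  fps_mulA fps_mulC fps_mul1 fps_mulDl fps_1neq0.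

Definition fps_unit : {pred fps R} := fun a => `[< exists b, b * a = 1 >].
Definition fps_inv a : fps R :=
  if pselect (exists b, b * a = 1) is left h then projT1 (cid h) else a.

Lemma fps_mulV : {in fps_unit, left_inverse 1 fps_inv *%R}.
Proof.
move=> a /asboolP ha; rewrite /fps_inv; case: pselect => // h.
by case: cid.
Qed.
Lemma fps_unitP a b : b * a = 1 -> fps_unit a.
Proof. by move=> ba; apply/asboolP; exists b. Qed.
Lemma fps_inv_out : {in [predC fps_unit], fps_inv =1 id}.
Proof.
move=> a /negP ha; rewrite /fps_inv; case: pselect => // h.
by case: ha; apply/asboolP.
Qed.

HB.instance Definition _ := GRing.ComNzRing_hasMulInverse.Build (fps R)
  fps_mulV fps_unitP fps_inv_out.

Lemma fps_order a : a != 0 ->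
  exists2 m, fcoef a m != 0 & forall i, (i < m)%N -> fcoef a i = 0.
Proof.
move=> a0; have /ex_minnP[m am min_m] : exists m, fcoef a m != 0.
  apply: contrapT => nex; move/eqP: a0; apply; apply/fpsP => n.
  by apply: contrapT => an; apply: nex; exists n; apply/eqP.
exists m => // i im; apply/eqP; apply: contraTT im => /min_m.
by rewrite -leqNgt.
Qed.

Lemma fps_mulf_eq0 a b : a * b = 0 -> (a == 0) || (b == 0).
Proof.
move=> ab0; case: eqVneq => //= /fps_order[i ai mini].
case: eqVneq => //= /fps_order[j bj minj].
move/fpsP/(_ (i + j)%N): ab0 => /=.
rewrite (bigD1 (Ordinal (leq_addr j i : (i < (i + j).+1)%N))) //= big1 => [|k ki].
  by move/eqP; rewrite addr0 addKn mulf_eq0 (negPf ai) (negPf bj).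
have [lt_ki|] := ltnP k i; first by rewrite mini ?mul0r.
rewrite leq_eqVlt => /predU1P[ik|lt_ik].
  by case/eqP: ki; apply: val_inj.
rewrite (minj (i + j - k)%N) ?mulr0 // ltn_subLR ?leq_ord //.
by rewrite ltn_add2r.
Qed.

HB.instance Definition _ :=
  GRing.ComUnitRing_isIntegral.Build (fps R) fps_mulf_eq0.

End FpsRing.

Arguments fpsX {R}.

(* C[[x]][[y]][[z]]. *)
Definition fps3 (C : idomainType) : idomainType := fps (fps (fps C)).

Section Fps3.
Variable C : idomainType.

Definition Fps3 (f : nat -> nat -> nat -> C) : fps3 C :=
  Fps (fun l => Fps (fun j => Fps (fun i => f i j l))).
Definition fcoef3 (a : fps3 C) i j l : C := fcoef (fcoef (fcoef a l) j) i.

Definition varx : fps3 C := fpsC (fpsC fpsX).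
Definition vary : fps3 C := fpsC fpsX.
Definition varz : fps3 C := fpsX.

(* 1 + \sum_(r >= 1) \sum_(0 <= s <= r) \sum_(k >= r + s)
         G k r s * x ^ (k - r - s) * y ^ (r - s) * z ^ s :
   the monomial x ^ i y ^ j z ^ l comes from the single triple
   s = l, r = j + l, k = i + r + s. *)
Definition hgf (G : nat -> nat -> nat -> C) : fps3 C :=
  1 + Fps3 (fun i j l =>
        let s := l in let r := (j + l)%N in let k := (i + r + s)%N in
        if (0 < r)%N then G k r s else 0).

Lemma fcoef3_hgf G k r s : (0 < r)%N -> (s <= r)%N -> (r + s <= k)%N ->
  fcoef3 (hgf G) (k - r - s) (r - s) s = G k r s.
Proof.
move=> r0 sr rsk; rewrite /fcoef3 /hgf /=.
have -> : (r - s + s)%N = r by rewrite subnK.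
have -> : (k - r - s + r + s)%N = k by rewrite -subnDA -addnA subnK.
rewrite r0; case: s sr {rsk} => [|s] sr; last by rewrite /= add0r.
by rewrite /= subn0; case: r r0 {sr} => //= r _; rewrite add0r.
Qed.

Lemma fcoef3_hgf0 G i : fcoef3 (hgf G) i 0 0 = (i == 0%N)%:R.
Proof. by rewrite /fcoef3 /hgf /= addr0; case: i. Qed.

End Fps3.

Section MultipleHarmonic.
Variable C : fieldType.

Definition wt r (k : 'I_r -> nat) : nat := (\sum_(a < r) k a)%N.
Definition height r (k : 'I_r -> nat) : nat := #|[set a : 'I_r | (1 < k a)%N]|.

Definition qint (q : C) (m : nat) : C := (1 - q ^+ m) / (1 - q).

Definition zterm (q : C) r (k m : 'I_r -> nat) : C :=
  \prod_(i < r) (q ^+ ((k i).-1 * m i) / qint q (m i) ^+ k i).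

Definition zn (n : nat) r (k : 'I_r -> nat) (q : C) : C :=
  \sum_(m : {ffun 'I_r -> 'I_n} |
         [forall i : 'I_r, (0 < m i)%N] &&
         [forall i : 'I_r, forall j : 'I_r, (i < j)%N ==> (m j < m i)%N])
    zterm q k (fun i => m i).

Definition znstar (n : nat) r (k : 'I_r -> nat) (q : C) : C :=
  \sum_(m : {ffun 'I_r -> 'I_n} |
         [forall i : 'I_r, (0 < m i)%N] &&
         [forall i : 'I_r, forall j : 'I_r, (i < j)%N ==> (m j <= m i)%N])
    zterm q k (fun i => m i).

Definition zbar (n : nat) (zeta : C) r (k : 'I_r -> nat) : C :=
  (1 - zeta) ^- wt k * zn n k zeta.
Definition zbarstar (n : nat) (zeta : C) r (k : 'I_r -> nat) : C :=
  (1 - zeta) ^- wt k * znstar n k zeta.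

(* Entries of an index of weight k are at most k, so {0, ..., k} suffices as
   codomain. *)
Definition indices (k r s : nat) : {set {ffun 'I_r -> 'I_k.+1}} :=
  [set f : {ffun 'I_r -> 'I_k.+1} | [&& [forall a : 'I_r, (0 < f a)%N],
     wt (fun a => f a) == k & height (fun a => f a) == s]].

Definition sum_zbar (n : nat) (zeta : C) (k r s : nat) : C :=
  \sum_(f in indices k r s) zbar n zeta (fun a => f a).
Definition sum_zbarstar (n : nat) (zeta : C) (k r s : nat) : C :=
  \sum_(f in indices k r s) zbarstar n zeta (fun a => f a).

Definition Fn (n : nat) (zeta : C) : fps3 C := hgf (sum_zbar n zeta).
Definition Fnstar (n : nat) (zeta : C) : fps3 C := hgf (sum_zbarstar n zeta).

End MultipleHarmonic.

(* A rational expression, to be evaluated in the fraction field of the power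
   series ring, where (1 + x) ^+ n - 1 is invertible. *)
Definition Un (K : fieldType) (n : nat) (x y z : K) : K :=
  x / ((1 + x) ^+ n - 1) *
  \sum_(a < n) \sum_(b < n | (a + b <= n - 1)%N)
    ((n - a - b)%N%:R^-1 * 'C(n - a - 1, b)%:R * 'C(n - b - 1, a)%:R
     * (1 + x) ^+ a * (1 + y) ^+ b * (x * y - z) ^+ (n - 1 - a - b)).

(* Main.v *)
Require Import Defs.
From HB Require Import structures.
From mathcomp Require Import all_boot all_order all_algebra.
From mathcomp Require Import ring.

Set Implicit Arguments.
Unset Strict Implicit.
Unset Printing Implicit Defensive.

Import GRing.Theory Num.Theory.
Local Open Scope ring_scope.

(* Put A = 1 + x, B = 1 + y, w = x y - z and t = zeta^m. Summing over all indices
   and all decreasing chains turns F into a product over 0 < m < n of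
   1 + phi_m, and F* into the inverse of the product of 1 - phi_m, where
     phi_m = y / (1 - t) + z t / ((1 - t) (1 - A t)),
     (1 - t) (1 - A t) (1 + phi_m) = B - (A + B + w) t + A t^2.
   The product of the right-hand sides over all n-th roots of unity is a
   resultant, equal to A^n + B^n - (p^n + q^n) with p + q = A + B + w and
   p q = A B. Since (1 - p u) (1 - q u) = (1 - A u) (1 - B u) - w u, taking
   logarithms gives
     p^n + q^n = A^n + B^n
       + sum over a + b + j = n, j > 0, of (n / j) C(j+a-1, a) C(j+b-1, b) A^a B^b w^j,
   and both sides satisfy the same recursion of order 2 in n. Dividing by the factor
   -w at t = 1 yields U. Rationality follows because F and F* are quotients of
   series with rational coefficients whose denominators have nonzero constant
   term. *)

(** * The resultant of a quadratic and X^n - 1 *)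

Lemma det_mx22 (R : comNzRingType) (M : 'M[R]_2) :
  \det M = M 0 0 * M 1 1 - M 0 1 * M 1 0.
Proof.
rewrite (expand_det_row M 0) !big_ord_recl big_ord0 /cofactor !det_mx11 !mxE /=.
have -> : lift 0 0 = 1 :> 'I_2 by apply: val_inj.
have -> : lift 1 0 = 0 :> 'I_2 by apply: val_inj.
by rewrite expr0 expr1 addr0 mul1r mulN1r mulrN.
Qed.

Lemma mxtrace22 (R : comNzRingType) (M : 'M[R]_2) : \tr M = M 0 0 + M 1 1.
Proof.
rewrite /mxtrace !big_ord_recl big_ord0 addr0.
by have -> : lift 0 0 = 1 :> 'I_2 by apply: val_inj.
Qed.

Lemma mul_mx22 (R : comNzRingType) (M N : 'M[R]_2) i j :
  (M * N) i j = M i 0 * N 0 j + M i 1 * N 1 j.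
Proof.
rewrite mxE !big_ord_recl big_ord0 addr0.
by have -> : lift 0 0 = 1 :> 'I_2 by apply: val_inj.
Qed.

Lemma Cayley_Hamilton22 (R : comNzRingType) (M : 'M[R]_2) :
  M ^+ 2 = \tr M *: M - (\det M)%:M.
Proof.
have e2 (i : 'I_2) : i = 0 \/ i = 1.
  by case: i => [[|[|]]] // ?; [left|right]; apply: val_inj.
apply/matrixP => i j; rewrite expr2 mul_mx22 mxtrace22 det_mx22 !mxE.
by case: (e2 i) => ->; case: (e2 j) => ->; rewrite /= ?mulr1n ?mulr0n; ring.
Qed.

Lemma det_sub_scalar22 (R : comNzRingType) (M : 'M[R]_2) a :
  \det (M - a%:M) = \det M - a * \tr M + a ^+ 2.
Proof. by rewrite !det_mx22 mxtrace22 !mxE /= ?mulr1n ?mulr0n; ring. Qed.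

(** Multiply Cayley-Hamilton by [M ^+ n] and take traces. These traces stand in for the power sums
    of the eigenvalues, which need not lie in [R]. *)
Lemma mxtrace_exprSS22 (R : comNzRingType) (M : 'M[R]_2) n :
  \tr (M ^+ n.+2) = \tr M * \tr (M ^+ n.+1) - \det M * \tr (M ^+ n).
Proof.
have -> : M ^+ n.+2 = M ^+ n * M ^+ 2 by rewrite -exprD addn2.
rewrite Cayley_Hamilton22 mulrBr linearB /= -scalerAr.
by rewrite mxtraceZ -exprSr [X in _ - \tr X]mul_mx_scalar mxtraceZ.
Qed.

(** Evaluate the factorization of ['X^n - 1] into the factors ['X - zeta ^+ i] at [M], then take
    determinants. *)
Lemma prod_det_unity_roots (K : fieldType) (zeta : K) (m n : nat)
    (M : 'M[K]_m.+1) :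
  n.-primitive_root zeta ->
  \prod_(0 <= i < n) \det (M - (zeta ^+ i)%:M) = \det (M ^+ n - 1).
Proof.
move=> pz.
have -> : M ^+ n - 1 = horner_mx M ('X^n - 1).
  by rewrite rmorphB rmorphXn rmorph1 /= horner_mx_X.
rewrite -(factor_Xn_sub_1 pz) rmorph_prod.
rewrite (@big_morph _ _ (fun A : 'M[K]_m.+1 => \det A) 1 *%R 1 *%R) ?det1 //.
  by apply: eq_bigr => i _; rewrite rmorphB /= horner_mx_X horner_mx_C.
by move=> A B; rewrite -det_mulmx.
Qed.

(* The product is the resultant of [A X^2 - S X + B] and [X^n - 1]; the
   companion matrix replaces the roots of the quadratic, which need not lie in
   [K]. *)
Lemma prod_quadratic_unity_roots (K : fieldType) (zeta : K) (n : nat)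
    (L : nat -> K) (A B S : K) :
  n.-primitive_root zeta -> A != 0 ->
  L 0%N = 2%:R -> L 1%N = S ->
  (forall k, L k.+2 = S * L k.+1 - A * B * L k) ->
  \prod_(0 <= i < n) (B - S * zeta ^+ i + A * (zeta ^+ i) ^+ 2) =
  A ^+ n + B ^+ n - L n.
Proof.
move=> pz A0 L0 L1 LSS.
pose M : 'M[K]_2 := \matrix_(i, j)
  if i == 0 then (if j == 0 then S / A else - (B / A))
  else (if j == 0 then 1 else 0).
have trM : \tr M = S / A by rewrite mxtrace22 !mxE /= addr0.
have detM : \det M = B / A by rewrite det_mx22 !mxE /= mulr0 mulr1 sub0r opprK.
(* Both sides satisfy the same recursion of order 2, so the induction carries two consecutive
   values. *)
have LE k : L k = A ^+ k * \tr (M ^+ k) /\ L k.+1 = A ^+ k.+1 * \tr (M ^+ k.+1).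
  elim: k => [|k [IH0 IH1]]; split=> //.
  - by rewrite L0 !expr0 mxtrace1 mul1r.
  - by rewrite L1 !expr1 trM mulrC divfK.
  - rewrite LSS IH0 IH1 mxtrace_exprSS22 trM detM !exprS; field; exact: A0.
have -> : \prod_(0 <= i < n) (B - S * zeta ^+ i + A * (zeta ^+ i) ^+ 2) =
  \prod_(0 <= i < n) (A * \det (M - (zeta ^+ i)%:M)).
  apply: eq_bigr => i _.
  by rewrite det_sub_scalar22 trM detM; field; exact: A0.
rewrite big_split /= prod_det_unity_roots // prodr_const_nat subn0.
rewrite det_sub_scalar22 (LE n).1 mul1r expr1n !mulrDr mulrN mulr1.
have detX k : \det (M ^+ k) = \det M ^+ k.
  by elim: k => [|k IH]; rewrite ?det1 // !exprS det_mulmx IH.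
by rewrite detX detM -exprMn [A * _]mulrC divfK // (addrC (A ^+ n)) addrAC.
Qed.

(** * The Lucas form *)

Section HomogeneousForms.
Variables (R : comNzRingType) (A B w : R).
Implicit Types (e : nat -> nat -> nat -> R) (n a b j : nat).

Definition form3 e n : R :=
  \sum_(a < n.+1) \sum_(b < (n - a).+1)
    e a b (n - a - b)%N * A ^+ a * B ^+ b * w ^+ (n - a - b).

Lemma eq_form3 e e' n :
  (forall a b j, (a + b + j = n)%N -> e a b j = e' a b j) ->
  form3 e n = form3 e' n.
Proof.
move=> ee; apply: eq_bigr => a _; apply: eq_bigr => b _; rewrite ee //.
have := ltn_ord a; have := ltn_ord b; rewrite !ltnS => lb la.
by rewrite -addnA subnKC // subnKC.
Qed.

Lemma form3D e e' n :
  form3 (fun a b j => e a b j + e' a b j) n = form3 e n + form3 e' n.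
Proof.
rewrite -big_split; apply: eq_bigr => a _ /=; rewrite -big_split.
by apply: eq_bigr => b _ /=; rewrite !mulrDl.
Qed.

Lemma form3N e n : form3 (fun a b j => - e a b j) n = - form3 e n.
Proof.
rewrite -sumrN; apply: eq_bigr => a _ /=; rewrite -sumrN.
by apply: eq_bigr => b _ /=; rewrite !mulNr.
Qed.

(** Coefficients after multiplication by [A], [B] or [w]: a recursion between forms becomes an
    identity between coefficients. *)
Definition shiftA e a b j := if a is a'.+1 then e a' b j else 0.
Definition shiftB e a b j := if b is b'.+1 then e a b' j else 0.
Definition shiftw e a b j := if j is j'.+1 then e a b j' else 0.

Lemma form3_shiftA e n : form3 (shiftA e) n.+1 = A * form3 e n.
Proof.
rewrite /form3 big_ord_recl big1 ?add0r => [|b _]; last by rewrite /= !mul0r.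
rewrite mulr_sumr; apply: eq_bigr => a _; rewrite lift0 subSS mulr_sumr.
by apply: eq_bigr => b _ /=; rewrite exprS; ring.
Qed.

Lemma form3_shiftB e n : form3 (shiftB e) n.+1 = B * form3 e n.
Proof.
rewrite /form3 big_ord_recr /= subnn big_ord1 /= !mul0r addr0.
rewrite mulr_sumr; apply: eq_bigr => a _; rewrite mulr_sumr.
rewrite subSn -1?ltnS // big_ord_recl /= !mul0r add0r.
by apply: eq_bigr => b _ /=; rewrite subSS exprS; ring.
Qed.

Lemma form3_shiftw e n : form3 (shiftw e) n.+1 = w * form3 e n.
Proof.
rewrite /form3 big_ord_recr /= subnn big_ord1 /= subn0 !mul0r addr0.
rewrite mulr_sumr; apply: eq_bigr => a _; rewrite mulr_sumr.
rewrite subSn -1?ltnS // big_ord_recr /= subnn /= !mul0r addr0.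
apply: eq_bigr => b _ /=; rewrite subSn -1?ltnS //= exprS; ring.
Qed.

End HomogeneousForms.

(* [mchoose j a] is the coefficient of [u^a] in [(1 - u)^(-j)]; truncated
   subtraction makes it right for [j = 0] as well. *)
Definition mchoose (j a : nat) : nat := 'C((j + a).-1, a).
(** The coefficient of [u^a] in [u (1 - u)^(-j-1)]. It equals [a / j * mchoose j a] for [j > 0] and
    still makes sense at [j = 0]. *)
Definition mchoose' (j a : nat) : nat :=
  if a is a'.+1 then mchoose j.+1 a' else 0.

(** Compare coefficients of [u^(a+1)] in [(1 - u)^(-j-1) (1 - u) = (1 - u)^(-j)]. *)
Lemma mchooseSS j a :
  mchoose j.+1 a.+1 = (mchoose j.+1 a + mchoose j a.+1)%N.
Proof. by rewrite /mchoose !addSn !addnS /= binS addnC. Qed.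

Lemma mchoose'SS j a :
  mchoose' j.+1 a.+1 = (mchoose' j.+1 a + mchoose' j a.+1)%N.
Proof.
case: a => [|a]; first by rewrite /= /mchoose !bin0.
by rewrite /= mchooseSS.
Qed.

Lemma mul_mchoose' j a : (j * mchoose' j a = a * mchoose j a)%N.
Proof.
case: a => [|a]; first by rewrite muln0.
by rewrite /= /mchoose addSn addnS /= mul_bin_left addnK.
Qed.

Lemma mchoose0S a : mchoose 0 a.+1 = 0%N.
Proof. by rewrite /mchoose /= bin_small. Qed.

Lemma mchoosen0 j : mchoose j 0 = 1%N.
Proof. by rewrite /mchoose bin0. Qed.

(* The coefficients [n / j * mchoose j a * mchoose j b], [n = a + b + j], of the
   expansion of [p^n + q^n] when [p + q = A + B + w] and [p q = A B], written
   without division so that [j = 0] is allowed. *)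
Definition lucas3 (a b j : nat) : nat :=
  mchoose' j a * mchoose j b + mchoose j a * mchoose' j b
  + mchoose j a * mchoose j b.

Lemma mul_lucas3 a b j :
  (j * lucas3 a b j = (a + b + j) * (mchoose j a * mchoose j b))%N.
Proof.
rewrite /lucas3 !mulnDr mulnA mul_mchoose' mulnCA mul_mchoose'.
rewrite !mulnDl. ring.
Qed.

(** At [w = 0] the pair [p, q] becomes [A, B], so only the pure powers of [A] and of [B] survive. *)
Lemma lucas3_0 a b :
  lucas3 a b 0 = (((a == 0) || (b == 0)) : nat)%N.
Proof.
rewrite /lucas3; case: a => [|a]; case: b => [|b];
  by rewrite /= ?mchoose0S ?mchoosen0 ?mul0n ?muln0 //= /mchoose addnC /= binn.
Qed.

(** The recursion [L_n = (A + B + w) L_(n-1) - A B L_(n-2)] on coefficients. It starts in degree 3: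
    in degree 2 it would involve [lucas3 0 0 0 = 1] where [L_0 = 2] is required. *)
Lemma lucas3_rec (R : comNzRingType) a b j n :
  (a + b + j)%N = n.+3 ->
  (lucas3 a b j)%:R =
    shiftA (fun a b j => (lucas3 a b j)%:R) a b j
    + shiftB (fun a b j => (lucas3 a b j)%:R) a b j
    + shiftw (fun a b j => (lucas3 a b j)%:R) a b j
    - shiftA (shiftB (fun a b j => (lucas3 a b j)%:R)) a b j :> R.
Proof.
case: j => [|j] abj.
  case: a b abj => [|[|a]] [|[|b]] //= _; rewrite !lucas3_0 /=; ring.
case: a b {abj} => [|a] [|b] /=; rewrite /lucas3 ?mchoosen0 ?mchooseSS
  ?mchoose'SS /= ?natrD ?natrM ?natrD; ring.
Qed.

Section LucasForm.
Variables (R : comNzRingType) (A B w : R).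

(* [form3] would give [1] at [n = 0], but [p^0 + q^0 = 2]. *)
Definition lucas_form n : R :=
  if n is 0 then 2%:R else form3 A B w (fun a b j => (lucas3 a b j)%:R) n.

Lemma lucas_form1 : lucas_form 1 = A + B + w.
Proof.
rewrite /lucas_form /form3 !big_ord_recl !big_ord0 /=.
transitivity (1%N%:R * A ^+ 0 * B ^+ 0 * w ^+ 1 +
  (1%N%:R * A ^+ 0 * B ^+ 1 * w ^+ 0 + 0) +
  (1%N%:R * A ^+ 1 * B ^+ 0 * w ^+ 0 + 0 + 0)); [by [] | ring].
Qed.

Lemma lucas_form2 : lucas_form 2 = (A + B + w) ^+ 2 - 2%:R * A * B.
Proof.
rewrite /lucas_form /form3 !big_ord_recl !big_ord0 /=.
transitivity (1%N%:R * A ^+ 0 * B ^+ 0 * w ^+ 2 +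
  (2%N%:R * A ^+ 0 * B ^+ 1 * w ^+ 1 +
    (1%N%:R * A ^+ 0 * B ^+ 2 * w ^+ 0 + 0)) +
  (2%N%:R * A ^+ 1 * B ^+ 0 * w ^+ 1 +
     (0%N%:R * A ^+ 1 * B ^+ 1 * w ^+ 0 + 0) +
  (1%N%:R * A ^+ 2 * B ^+ 0 * w ^+ 0 + 0 + 0))); [by [] | ring].
Qed.

Lemma lucas_formSS n :
  lucas_form n.+2 = (A + B + w) * lucas_form n.+1 - A * B * lucas_form n.
Proof.
case: n => [|n]; first by rewrite lucas_form1 lucas_form2 /=; ring.
rewrite /lucas_form (eq_form3 A B w (fun a b j => @lucas3_rec R a b j n)).
rewrite !form3D form3N !form3_shiftA form3_shiftB form3_shiftw form3_shiftB.
by rewrite !mulrDl mulrA.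
Qed.

(** This is [(p^(n+1) + q^(n+1) - A^(n+1) - B^(n+1)) / w], written without division. *)
Definition lucas_quotient n : R :=
  form3 A B w (fun a b j => (lucas3 a b j.+1)%:R) n.

Lemma lucas_formS n :
  lucas_form n.+1 = A ^+ n.+1 + B ^+ n.+1 + w * lucas_quotient n.
Proof.
(* [e0] holds the part free of [w], which contributes exactly [A ^+ n.+1 + B ^+ n.+1]. *)
pose e0 a b j : R := (j == 0%N)%:R * ((a == 0%N) || (b == 0%N))%:R.
rewrite -form3_shiftw /lucas_form.
rewrite (@eq_form3 _ A B w _ (fun a b j => e0 a b j
  + shiftw (fun a b j => (lucas3 a b j.+1)%:R) a b j)); last first.
  by case=> [|a] [|b] [|j] _; rewrite /e0 /= ?lucas3_0 ?mul1r ?mul0r ?addr0 ?add0r.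
rewrite form3D; congr (_ + _).
rewrite /form3 big_ord_recr /= subnn big_ord1 /e0 /= !mul1r !mulr1 addrC.
congr (_ + _).
rewrite big_ord_recl [X in _ + X]big1 ?addr0 => [|a _].
  rewrite big_ord_recr big1 /= ?subn0 ?subnn => [|b _].
    by rewrite !mul1r !mulr1 add0r.
  by rewrite subn_eq0 leqNgt ltn_ord !mul0r.
rewrite lift0 big1 // => b _ /=; case: (nat_of_ord b) => [|b'].
  by rewrite subn0 subSS subn_eq0 leqNgt ltn_ord !mul0r.
by rewrite mulr0 !mul0r.
Qed.
End LucasForm.

(** With [j = n - a - b] the two binomials are [mchoose j.+1 b] and [mchoose j.+1 a], so
    [mul_lucas3] turns each term of the sum in [Un] into [lucas3 a b j.+1 / n.+1]. Characteristic 0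
    makes [j.+1] and [n.+1] invertible. *)
Lemma mul_lucas_quotient (K : fieldType) n (A B w : K) :
  [pchar K] =i pred0 ->
  \sum_(a < n.+1) \sum_(b < n.+1 | (a + b <= n.+1 - 1)%N)
    ((n.+1 - a - b)%N%:R^-1 * 'C(n.+1 - a - 1, b)%:R * 'C(n.+1 - b - 1, a)%:R
     * A ^+ a * B ^+ b * w ^+ (n.+1 - 1 - a - b)) =
  lucas_quotient A B w n / n.+1%:R.
Proof.
move=> charK0; rewrite /lucas_quotient /form3 mulr_suml subn1 /=.
have nz m : (m.+1%:R : K) != 0 by rewrite (pcharf0P K).1.
apply: eq_bigr => a _; have la : (a <= n)%N by rewrite -ltnS.
rewrite mulr_suml (big_ord_widen n.+1 (fun b => (lucas3 a b (n - a - b).+1)%:R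
  * A ^+ a * B ^+ b * w ^+ (n - a - b) / n.+1%:R)) ?ltnS ?leq_subr //.
apply: eq_big => [b|b lab]; first by rewrite ltnS leq_subRL.
move: (nat_of_ord a) (nat_of_ord b) la lab => {}a {}b la lab.
set j := (n - a - b)%N.
have n1 : n.+1 = (a + b + j.+1)%N by rewrite addnS /j -subnDA subnKC.
have -> : (n.+1 - a - b)%N = j.+1 by rewrite n1 -subnDA addKn.
have -> : 'C(n.+1 - a - 1, b) = mchoose j.+1 b.
  by rewrite n1 -addnA addKn addnC subn1.
have -> : 'C(n.+1 - b - 1, a) = mchoose j.+1 a.
  by rewrite n1 (addnC a) -addnA addKn addnC subn1.
have -> : (lucas3 a b j.+1)%:R =
    n.+1%:R * ((mchoose j.+1 a)%:R * (mchoose j.+1 b)%:R) / j.+1%:R :> K.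
  apply: (mulfI (nz j)); rewrite mulrCA divff // mulr1.
  by rewrite -!natrM mul_lucas3 -n1.
rewrite -/j; move: n.+1%:R j.+1%:R (nz n) (nz j) => u v u0 v0.
by field; apply/andP.
Qed.

(** * Products over the roots of unity other than 1 *)

Section UnityRoots.
Variables (K : fieldType) (zeta : K) (n : nat).
Hypothesis pz : n.+1.-primitive_root zeta.

(** Cancel ['X - 1] from the factorization of ['X^n.+1 - 1] and evaluate at 1. *)
Lemma prod_1sub_unity_roots : \prod_(1 <= i < n.+1) (1 - zeta ^+ i) = n.+1%:R.
Proof.
have := factor_Xn_sub_1 pz; rewrite big_ltn // expr0 subrX1.
move/(mulfI (monic_neq0 (monicXsubC 1))).
move/(congr1 (horner^~ 1)); rewrite horner_prod horner_sum.
under [X in X = _]eq_bigr => i _ do rewrite hornerXsubC.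
by under [X in _ = X]eq_bigr => i _ do rewrite hornerXn expr1n;
  rewrite sumr_const card_ord.
Qed.

(** Evaluate the factorization at [A^-1], multiply by [A ^+ n.+1] and remove the factor of index
    0. *)
Lemma prod_1subM_unity_roots (A : K) : A != 0 -> A != 1 ->
  \prod_(1 <= i < n.+1) (1 - A * zeta ^+ i) = (A ^+ n.+1 - 1) / (A - 1).
Proof.
move=> A0 A1; have A1' : A - 1 != 0 by rewrite subr_eq0.
have := congr1 (horner^~ A^-1) (factor_Xn_sub_1 pz); rewrite horner_prod.
under eq_bigr => i _ do rewrite hornerXsubC.
rewrite hornerD hornerN hornerXn hornerC => /(congr1 ( *%R (A ^+ n.+1))).
have {1}-> : A ^+ n.+1 = \prod_(0 <= i < n.+1) A by rewrite prodr_const_nat subn0.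
rewrite -big_split /= big_ltn // expr0.
rewrite mulrBr mulfV // mulr1 mulrBr exprVn mulfV ?expf_neq0 // mulr1.
under eq_bigr => i _ do rewrite mulrBr mulfV //.
move=> E; apply: (mulfI A1'); rewrite mulrCA divff // mulr1.
by rewrite -opprB mulNr E opprB.
Qed.

(** The full product is [- w * lucas_quotient A B w n], and its factor of index 0 is [- w]. *)
Lemma prod_quadratic_lucas_quotient (A B w : K) : A != 0 -> w != 0 ->
  \prod_(1 <= i < n.+1)
    (B - (A + B + w) * zeta ^+ i + A * (zeta ^+ i) ^+ 2) =
  lucas_quotient A B w n.
Proof.
move=> A0 w0; apply: (mulfI w0); apply: oppr_inj.
have := @prod_quadratic_unity_roots _ _ _ (lucas_form A B w) A B (A + B + w) pz A0.
rewrite lucas_form1 lucas_formS opprD addNKr big_ltn // => E.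
rewrite -E //; last by move=> k; rewrite lucas_formSS.
by rewrite expr0 -mulNr; congr (_ * _); ring.
Qed.
End UnityRoots.

(** * Coefficients of power series in three variables *)

Section FpsCoefficients.
Variable R : idomainType.
Implicit Types a b : fps R.

Lemma fcoefD a b n : fcoef (a + b) n = fcoef a n + fcoef b n.
Proof. by []. Qed.
Lemma fcoefN a n : fcoef (- a) n = - fcoef a n.
Proof. by []. Qed.
Lemma fcoefM a b n :
  fcoef (a * b) n = \sum_(i < n.+1) fcoef a i * fcoef b (n - i)%N.
Proof. by []. Qed.
Lemma fcoef1 n : fcoef (1 : fps R) n = (n == 0%N)%:R.
Proof. by case: n. Qed.
Lemma fcoefC (c : R) n : fcoef (fpsC c) n = if n == 0%N then c else 0.
Proof. by []. Qed.

Lemma fcoef_sum I (r : seq I) (P : pred I) (F : I -> fps R) n :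
  fcoef (\sum_(i <- r | P i) F i) n = \sum_(i <- r | P i) fcoef (F i) n.
Proof. by apply: (big_morph (fun a => fcoef a n)). Qed.

Lemma fcoefCM (c : R) a n : fcoef (fpsC c * a) n = c * fcoef a n.
Proof.
rewrite fcoefM big_ord_recl subn0 big1 ?addr0 // => i _.
by rewrite fcoefC /= mul0r.
Qed.

Lemma fcoefXM a n : fcoef (fpsX * a) n = if n is m.+1 then fcoef a m else 0.
Proof.
rewrite fcoefM big_ord_recl mul0r add0r; case: n => [|n]; first by rewrite big_ord0.
rewrite big_ord_recl mul1r subSS subn0 big1 ?addr0 // => i _.
by rewrite /= mul0r.
Qed.

Lemma fcoefXn m n : fcoef (fpsX ^+ m : fps R) n = (n == m)%:R.
Proof.
elim: m n => [|m IH] n; first by rewrite expr0 fcoef1.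
by rewrite exprS fcoefXM; case: n.
Qed.

Fact fpsC_is_additive : zmod_morphism (@fpsC R).
Proof.
by move=> c d; apply/fpsP => n; rewrite fcoefD fcoefN !fcoefC; case: eqP; rewrite ?subr0.
Qed.
Fact fpsC_is_monoid_morphism : monoid_morphism (@fpsC R).
Proof.
split=> // c d; apply/fpsP => n; rewrite fcoefCM !fcoefC.
by case: eqP; rewrite ?mulr0.
Qed.
HB.instance Definition _ := GRing.isZmodMorphism.Build R (fps R) (@fpsC R) fpsC_is_additive.
HB.instance Definition _ := GRing.isMonoidMorphism.Build R (fps R) (@fpsC R)
  fpsC_is_monoid_morphism.

End FpsCoefficients.

Section Fps3Coefficients.
Variable C : idomainType.
Implicit Types a b c : fps3 C.

Lemma fcoef3P a b : (forall i j l, fcoef3 a i j l = fcoef3 b i j l) -> a = b.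
Proof. by move=> ab; apply/fpsP => l; apply/fpsP => j; apply/fpsP => i; apply: ab. Qed.

Lemma fcoef3D a b i j l : fcoef3 (a + b) i j l = fcoef3 a i j l + fcoef3 b i j l.
Proof. by []. Qed.

Lemma fcoef3N a i j l : fcoef3 (- a) i j l = - fcoef3 a i j l.
Proof. by []. Qed.

Lemma fcoef3_sum I (r : seq I) (P : pred I) (F : I -> fps3 C) i j l :
  fcoef3 (\sum_(k <- r | P k) F k) i j l = \sum_(k <- r | P k) fcoef3 (F k) i j l.
Proof. by rewrite /fcoef3 !fcoef_sum. Qed.

Lemma fcoef3M a b i j l : fcoef3 (a * b) i j l =
  \sum_(l' < l.+1) \sum_(j' < j.+1) \sum_(i' < i.+1)
    fcoef3 a i' j' l' * fcoef3 b (i - i') (j - j') (l - l').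
Proof.
rewrite /fcoef3 fcoefM !fcoef_sum; apply: eq_bigr => l' _.
by rewrite fcoefM fcoef_sum; apply: eq_bigr => j' _; rewrite fcoefM.
Qed.

Definition fps3C (c : C) : fps3 C := fpsC (fpsC (fpsC c)).
HB.instance Definition _ := GRing.RMorphism.copy fps3C
  (@fpsC _ \o (@fpsC _ \o @fpsC C)).

Lemma fcoef3CM (c : C) a i j l : fcoef3 (fps3C c * a) i j l = c * fcoef3 a i j l.
Proof. by rewrite /fcoef3 !fcoefCM. Qed.

Lemma fcoef3_monomial i' j' l' i j l :
  fcoef3 (varx C ^+ i' * vary C ^+ j' * varz C ^+ l') i j l =
  ((i == i') && (j == j') && (l == l'))%:R.
Proof.
have -> : varx C ^+ i' * vary C ^+ j' =
    fpsC (fpsC (fpsX ^+ i') * fpsX ^+ j') :> fps3 C.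
  by rewrite rmorphM /= !rmorphXn.
rewrite /fcoef3 fcoefCM fcoefXn.
case: (l == l'); last by rewrite andbF mulr0.
rewrite mulr1 andbT fcoefCM fcoefXn.
case: (j == j'); last by rewrite andbF mulr0.
by rewrite mulr1 andbT fcoefXn.
Qed.

Lemma fcoef3_varzM a i j l :
  fcoef3 (varz C * a) i j l = if l is l'.+1 then fcoef3 a i j l' else 0.
Proof.
transitivity (fcoef (fcoef (if l is l'.+1 then fcoef a l' else 0) j) i).
  by congr (fcoef (fcoef _ j) i); apply: fcoefXM.
by case: l.
Qed.

Lemma fcoef3_1 i j l :
  fcoef3 (1 : fps3 C) i j l = ((i == 0%N) && (j == 0%N) && (l == 0%N))%:R.
Proof. by rewrite -(fcoef3_monomial 0 0 0) !expr0 !mulr1. Qed.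
End Fps3Coefficients.

(** * Sums over decreasing chains *)

Definition ffun_cons (T : Type) r (t : T) (m : {ffun 'I_r -> T}) :
    {ffun 'I_r.+1 -> T} :=
  [ffun i => if unlift ord0 i is Some j then m j else t].

Lemma ffun_cons0 (T : Type) r (t : T) (m : {ffun 'I_r -> T}) :
  ffun_cons t m ord0 = t.
Proof. by rewrite ffunE unlift_none. Qed.

Lemma ffun_consS (T : Type) r (t : T) (m : {ffun 'I_r -> T}) i :
  ffun_cons t m (lift ord0 i) = m i.
Proof. by rewrite ffunE liftK. Qed.

(** Splits off the first entry, which is the largest one in a chain; this gives the recursion on the
    depth. *)
Lemma big_ffun_cons (R : Type) (idx : R) (op : Monoid.com_law idx)
    (T : finType) r (P : pred {ffun 'I_r.+1 -> T}) (F : {ffun 'I_r.+1 -> T} -> R) :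
  \big[op/idx]_(m | P m) F m =
  \big[op/idx]_t \big[op/idx]_(m | P (ffun_cons t m)) F (ffun_cons t m).
Proof.
rewrite pair_big_dep /=.
rewrite (reindex (fun p : T * {ffun 'I_r -> T} => ffun_cons p.1 p.2)) //=.
exists (fun m => (m ord0, [ffun i => m (lift ord0 i)])) => [[t m] _ | m _] /=.
  by rewrite ffun_cons0; congr pair; apply/ffunP => i; rewrite ffunE ffun_consS.
apply/ffunP => i; case: (unliftP ord0 i) => [j|] ->.
  by rewrite ffun_consS ffunE.
by rewrite ffun_cons0.
Qed.

Section ChainSums.
Variables (R : comNzRingType) (n : nat) (phi : nat -> R).

(* Strictly decreasing chains for [d = false], weakly decreasing ones for
   [d = true]. *)
Definition chain (d : bool) N r (m : {ffun 'I_r -> 'I_n}) : bool :=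
  [&& [forall i : 'I_r, (0 < m i)%N],
      [forall i : 'I_r, forall j : 'I_r, (i < j)%N ==> (m j < d + m i)%N]
    & [forall i : 'I_r, (m i < N)%N]].

Definition chain_sum d N r : R :=
  \sum_(m : {ffun 'I_r -> 'I_n} | chain d N m) \prod_(i < r) phi (m i).

Lemma chainP (d : bool) N r (m : {ffun 'I_r -> 'I_n}) :
  reflect [/\ forall i, (0 < m i)%N,
             forall i j : 'I_r, (i < j)%N -> (m j < d + m i)%N
           & forall i, (m i < N)%N]
          (chain d N m).
Proof.
apply: (iffP and3P) => -[m0 md mN]; split.
- exact/forallP.
- by move=> i j; apply/implyP/(forallP (forallP md i)).
- exact/forallP.
- exact/forallP.
- by apply/forallP => i; apply/forallP => j; apply/implyP/md.
- exact/forallP.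
Qed.

(** Below a head [t], the tail is bounded by [t] in the strict case and by [t + 1] in the weak one,
    that is, by [d + t]; the bound [N] on the tail then follows from [t < N]. *)
Lemma chain_cons (d : bool) N r t (m : {ffun 'I_r -> 'I_n}) :
  chain d N (ffun_cons t m) = [&& (0 < t)%N, (t < N)%N & chain d (d + t) m].
Proof.
apply/chainP/and3P => [[m0 md mN] | [t0 tN /chainP[m0 md mt]]].
  split; [by have := m0 ord0; rewrite ffun_cons0
         | by have := mN ord0; rewrite ffun_cons0 | apply/chainP; split].
  - by move=> i; have := m0 (lift ord0 i); rewrite ffun_consS.
  - move=> i j ij; have := md (lift ord0 i) (lift ord0 j).
    by rewrite !ffun_consS; apply.
  - by move=> i; have := md ord0 (lift ord0 i); rewrite ffun_cons0 ffun_consS; apply.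
split.
- by move=> i; case: (unliftP ord0 i) => [k|] ->; rewrite ?ffun_cons0 ?ffun_consS.
- move=> i j; case: (unliftP ord0 j) => [k|] -> //; rewrite ffun_consS.
  by case: (unliftP ord0 i) => [k'|] ->; rewrite ?ffun_cons0 ?ffun_consS //; apply: md.
- move=> i; case: (unliftP ord0 i) => [k|] ->; rewrite ?ffun_cons0 ?ffun_consS //.
  have := mt k; case: (d); rewrite ?add1n ?add0n ?ltnS => mk.
    exact: leq_ltn_trans mk tN.
  exact: ltn_trans mk tN.
Qed.

Lemma chain_sum0 (d : bool) N : chain_sum d N 0 = 1.
Proof.
have E (m m' : {ffun 'I_0 -> 'I_n}) : m = m' by apply/ffunP => -[].
have m0 : {ffun 'I_0 -> 'I_n} by apply: finfun => -[].
rewrite /chain_sum (big_pred1 m0) ?big_ord0 // => m.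
by rewrite (E m m0) /= eqxx; apply/chainP; split=> -[].
Qed.

Lemma chain_sumS (d : bool) N r : (N <= n)%N ->
  chain_sum d N r.+1 = \sum_(1 <= t < N) phi t * chain_sum d (d + t) r.
Proof.
move=> Nn; rewrite /chain_sum big_ffun_cons big_nat_cond.
rewrite (big_nat_widenl 1 0) // (big_nat_widen 0 N n) // big_mkord.
rewrite [RHS]big_mkcond; apply: eq_bigr => t _.
case: ifP => [/andP[/andP[/andP[/andP[t0 tN] _] _] _] | H].
  rewrite mulr_sumr; apply: eq_big => [m|m _]; first by rewrite chain_cons t0 tN.
  rewrite big_ord_recl ffun_cons0; congr (_ * _).
  by apply: eq_bigr => i _; rewrite ffun_consS.
apply: big1 => m; rewrite chain_cons => /and3P[t0 tN _].
by rewrite t0 tN in H.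
Qed.

(** The additional chains are those whose head is [N]. *)
Lemma chain_sum_recr (d : bool) N r : (0 < N)%N -> (N < n)%N ->
  chain_sum d N.+1 r.+1 = chain_sum d N r.+1 + phi N * chain_sum d (d + N) r.
Proof.
by move=> N0 Nn; rewrite !chain_sumS ?(ltnW Nn) // big_nat_recr.
Qed.

Lemma chain_sum1 (d : bool) r : (0 < n)%N -> chain_sum d 1 r.+1 = 0.
Proof. by move=> n0; rewrite chain_sumS // big_geq. Qed.
End ChainSums.

Section ChainSeries.
Variables (C : idomainType) (n : nat) (phi : nat -> fps3 C).
Hypothesis phi_homog : forall m i j l,
  (j + l != 1)%N -> fcoef3 (phi m) i j l = 0.

(* [\sum_r c r], for [c r] homogeneous of degree [r] in [y] and [z]. *)
Definition hsum (c : nat -> fps3 C) : fps3 C :=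
  Fps3 (fun i j l => fcoef3 (c (j + l)%N) i j l).

Lemma fcoef3_hsum c i j l : fcoef3 (hsum c) i j l = fcoef3 (c (j + l)%N) i j l.
Proof. by []. Qed.

(** As [phi m] is homogeneous of degree 1 in [y] and [z], multiplying by it moves the piece of
    degree [r] to degree [r + 1]. *)
Lemma hsum_shift m c :
  hsum (fun r => if r is r'.+1 then phi m * c r' else 0) = phi m * hsum c.
Proof.
apply: fcoef3P => i j l; rewrite fcoef3_hsum fcoef3M.
transitivity (\sum_(l' < l.+1) \sum_(j' < j.+1) \sum_(i' < i.+1)
    fcoef3 (phi m) i' j' l' * fcoef3 (c (j + l).-1) (i - i') (j - j') (l - l')).
  case jl: (j + l)%N => [|r]; last by rewrite fcoef3M.
  move/eqP: jl; rewrite addn_eq0 => /andP[/eqP-> /eqP->].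
  rewrite [LHS](_ : _ = 0) // big1 // => l' _; rewrite big1 // => j' _.
  by rewrite big1 // => i' _; rewrite !ord1 phi_homog ?mul0r.
apply: eq_bigr => l' _; apply: eq_bigr => j' _; apply: eq_bigr => i' _.
have [jl1|/phi_homog->] := eqVneq (j' + l')%N 1%N; last by rewrite !mul0r.
have lj : (j' <= j)%N by rewrite -ltnS.
have ll : (l' <= l)%N by rewrite -ltnS.
by rewrite fcoef3_hsum -subn1 -jl1 subnDA addnBA // addnBAC.
Qed.

Definition chain_series (d : bool) N : fps3 C := hsum (chain_sum n phi d N).

Lemma chain_series1 (d : bool) : (0 < n)%N -> chain_series d 1 = 1.
Proof.
move=> n0; apply: fcoef3P => i j l; rewrite fcoef3_hsum.
case jl: (j + l)%N => [|r]; first by rewrite chain_sum0.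
by rewrite chain_sum1 // fcoef3_1; case: j l jl => [|j] [|l]; rewrite ?andbF.
Qed.

Lemma chain_series_recr (d : bool) N : (0 < N)%N -> (N < n)%N ->
  chain_series d N.+1 = chain_series d N + phi N * chain_series d (d + N).
Proof.
move=> N0 Nn; rewrite -hsum_shift; apply: fcoef3P => i j l.
rewrite fcoef3D !fcoef3_hsum; case: (j + l)%N => [|r].
  by rewrite !chain_sum0 addr0.
by rewrite chain_sum_recr.
Qed.

(** For strict chains [d + N = N], so passing from [N] to [N + 1] multiplies the series by
    [1 + phi N]. *)
Lemma chain_series_strict N : (0 < N)%N -> (N <= n)%N ->
  chain_series false N = \prod_(1 <= m < N) (1 + phi m).
Proof.
case: N => // N _; elim: N => [|N IH] Nn.
  by rewrite chain_series1 // big_geq.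
rewrite chain_series_recr // big_nat_recr //= -IH 1?ltnW //.
by rewrite mulrDr mulr1 [_ * phi _]mulrC.
Qed.

(** For weak chains [d + N = N + 1]: the new series occurs on both sides of the recursion, and
    [1 - phi N] times it is the old one. *)
Lemma chain_series_weak N : (0 < N)%N -> (N <= n)%N ->
  chain_series true N * \prod_(1 <= m < N) (1 - phi m) = 1.
Proof.
case: N => // N _; elim: N => [|N IH] Nn.
  by rewrite chain_series1 // big_geq // mulr1.
rewrite big_nat_recr //= mulrCA mulrC -[RHS](IH (ltnW Nn)).
congr (_ * _); rewrite mulrBr mulr1 [X in X - _]chain_series_recr // add1n.
by rewrite [phi _ * _]mulrC addrK.
Qed.
End ChainSeries.

(** * The product formulas *)

Lemma heightE r (k : 'I_r -> nat) : height k = (\sum_a (1 < k a)%N)%N.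
Proof.
by rewrite /height -sum1dep_card big_mkcond; apply: eq_bigr => a _; case: ifP.
Qed.

Section WeightSeries.
Variable C : idomainType.
Implicit Types (G : nat -> C) (i j l k K : nat).

(** The sum of [G k] times the monomial of a single part [k]: [y] for [k = 1], and [x^(k-2) z] for
    [k >= 2]. *)
Definition weight_series G : fps3 C :=
  fps3C (G 1%N) * vary C + varz C * fpsC (fpsC (Fps (fun i => G i.+2))).

Lemma fcoef3_weight_series G i j l : fcoef3 (weight_series G) i j l =
  if (j + l == 1)%N then
    if l == 1%N then G i.+2 else if i == 0%N then G 1%N else 0
  else 0.
Proof.
rewrite /weight_series fcoef3D fcoef3CM.
have -> : fcoef3 (vary C) i j l = ((i == 0%N) && (j == 1%N) && (l == 0%N))%:R.
  by rewrite -(fcoef3_monomial C 0 1 0) !expr0 expr1 mul1r mulr1.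
have E s l' : fcoef3 (fpsC (fpsC s) : fps3 C) i j l' =
    if (l' == 0%N) && (j == 0%N) then fcoef s i else 0.
  by case: l' => [|l']; case: (j).
rewrite (fcoef3_varzM (fpsC _)); case: l => [|[|l]].
- rewrite addn0 andbT addr0.
  by case: (j == 1%N); case: (i == 0%N); rewrite /= ?mulr1 ?mulr0.
- rewrite E andbF mulr0 add0r addn1 eqSS.
  by case: (j == 0%N).
- by rewrite E andbF mulr0 add0r !addnS.
Qed.

(** The monomial [x^i y^j z^l] belongs to depth [j + l] and height [l], hence to weight
    [i + j + 2 l]: this is equality up to weight [K]. *)
Definition agree K (a b : fps3 C) :=
  forall i j l, (i + j + l.*2 <= K)%N -> fcoef3 a i j l = fcoef3 b i j l.

Lemma agreeM K a a' b b' :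
  agree K a a' -> agree K b b' -> agree K (a * b) (a' * b').
Proof.
move=> aa bb i j l ijl; rewrite !fcoef3M.
apply: eq_bigr => l' _; apply: eq_bigr => j' _; apply: eq_bigr => i' _.
have li : (i' <= i)%N by rewrite -ltnS.
have lj : (j' <= j)%N by rewrite -ltnS.
have ll : (l' <= l)%N by rewrite -ltnS.
rewrite aa ?bb //; apply: leq_trans ijl.
  by rewrite !leq_add ?leq_double ?leq_subr.
by rewrite !leq_add ?leq_double.
Qed.

Lemma agree_prod K r (F F' : 'I_r -> fps3 C) :
  (forall a, agree K (F a) (F' a)) -> agree K (\prod_a F a) (\prod_a F' a).
Proof.
by move=> FF; apply: (big_ind2 (agree K)) => // *; apply: agreeM.
Qed.

Definition part_monomial k : fps3 C :=
  varx C ^+ (k - 2) * vary C ^+ (k == 1%N) * varz C ^+ (1 < k)%N.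

(** A part [k] has weight [k], so parts above [K] are invisible. The truncation is a finite sum,
    over which products can be distributed. *)
Lemma agree_weight_series G K :
  agree K (weight_series G)
    (\sum_(k < K.+1 | (0 < k)%N) fps3C (G k) * part_monomial k).
Proof.
move=> i j l ijl; rewrite fcoef3_weight_series fcoef3_sum.
under eq_bigr => k _ do rewrite fcoef3CM fcoef3_monomial.
rewrite big_mkcond big_ord_recl [X in _ = X + _]/= add0r.
case: K ijl => [|K] ijl.
  move: ijl; rewrite leqn0 !addn_eq0 double_eq0 big_ord0.
  by case/andP => /andP[_ /eqP->] /eqP->.
rewrite big_ord_recl [X in _ = _ + X](_ : _ =
  \sum_(k < K) G k.+2 * ((i == k) && ((j == 0%N) && (l == 1%N)))%:R); last first.
  by apply: eq_bigr => k _; rewrite /= /bump /= !add1n subn2 andbA.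
have -> : \sum_(k < K) G k.+2 * ((i == k) && ((j == 0%N) && (l == 1%N)))%:R =
    if (j == 0%N) && (l == 1%N) then G i.+2 else 0.
  case: ifP => [/andP[/eqP j0 /eqP l1] | _]; last first.
    by rewrite big1 // => k _; rewrite andbF mulr0.
  have iK : (i < K)%N by move: ijl; rewrite j0 l1 addn0 addn2 !ltnS.
  rewrite (bigD1 (Ordinal iK)) //= big1 => [|k]; first by rewrite eqxx mulr1 addr0.
  by rewrite -val_eqE /= eq_sym => /negPf->; rewrite mulr0.
rewrite [X in _ = X + _]/= /bump.
case: j l {ijl} => [|[|j]] [|[|l]]; rewrite ?addnS ?addn0 ?andbF ?mulr0 ?addr0 //=;
  rewrite ?andbF ?andbT ?mulr0 ?addr0 ?add0r //.
by case: (i == 0%N); rewrite ?mulr1 ?mulr0.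
Qed.

(** Truncate every factor at the weight in question and distribute: choosing one part from each
    factor is choosing an index. *)
Lemma fcoef3_prod_weight_series r (G : 'I_r -> nat -> C) i j l :
  (j + l)%N = r ->
  fcoef3 (\prod_a weight_series (G a)) i j l =
  \sum_(f in indices (i + r + l) r l) \prod_a G a (f a).
Proof.
move=> jlr; set k := (i + r + l)%N.
have ijl : (i + j + l.*2 <= k)%N by rewrite /k -jlr -addnn !addnA.
rewrite (agree_prod (fun a => agree_weight_series (G a) (K := k)) ijl).
rewrite bigA_distr_big fcoef3_sum.
rewrite [RHS]big_mkcond [LHS]big_mkcond; apply: eq_bigr => f _.
rewrite big_split -rmorph_prod fcoef3CM /= big_split big_split /= !prodrXr.
rewrite fcoef3_monomial.
have -> : f \in indices k r l = [&& [forall a, (0 < f a)%N],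
  wt (fun a => f a) == k & height (fun a => f a) == l] by rewrite inE.
have -> : f \in ffun_on (fun k0 : 'I_k.+1 => (0 < k0)%N) = [forall a, (0 < f a)%N].
  by apply/ffun_onP/forallP.
case: (@forallP _ (fun a => 0 < f a)%N) => //= f0.
have rE : r = (\sum_a (f a == 1 :> nat)%N + \sum_a (1 < f a)%N)%N.
  rewrite -big_split -[LHS]card_ord -sum1_card; apply: eq_bigr => a _.
  by have := f0 a; case: (nat_of_ord (f a)) => [|[|]].
have wE : wt (fun a => f a) = (\sum_a (f a - 2) + \sum_a (f a == 1 :> nat)%N
    + \sum_a (1 < f a) + \sum_a (1 < f a))%N.
  rewrite -!big_split; apply: eq_bigr => a _ /=.
  have := f0 a; case: (nat_of_ord (f a)) => [|[|q]] //= _.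
  by rewrite subSS subSS subn0 addn0 !addn1.
rewrite heightE wE -(addnA (\sum_a (f a - 2))%N) -rE.
move: (\sum_a (f a - 2))%N (\sum_a (f a == 1 :> nat))%N rE => X Y.
move: (\sum_a (1 < f a))%N => Z rE.
(* [X], [Y] and [Z] are the exponents of [x], [y] and [z]. Once [Z = l], both [j = Y] and the
   equivalence of [i = X] with the weight condition follow from [j + l = r = Y + Z]. *)
have -> : (i == X) && (j == Y) && (l == Z) = (X + r + Z == k)%N && (Z == l).
  rewrite [l == Z]eq_sym; case: (Z =P l) => [Zl|_]; last by rewrite !andbF.
  have -> : j == Y by rewrite -(eqn_add2r l) jlr rE Zl.
  by rewrite !andbT /k Zl !eqn_add2r eq_sym.
by case: ifP; rewrite ?mulr1 ?mulr0.
Qed.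
End WeightSeries.

Section GeneratingFunctions.
Variables (C : fieldType) (n : nat) (zeta : C).
Hypothesis pz : n.-primitive_root zeta.

Definition zfactor (m k : nat) : C :=
  zeta ^+ (k.-1 * m) / (1 - zeta ^+ m) ^+ k.

Definition zseries (m : nat) : fps3 C := weight_series (zfactor m).

Lemma zseries_homog m i j l : (j + l != 1)%N -> fcoef3 (zseries m) i j l = 0.
Proof. by move=> /negPf jl; rewrite fcoef3_weight_series jl. Qed.

(** The normalizing powers of [1 - zeta] cancel the denominators hidden in [qint]. *)
Lemma zterm_zfactor r (k : 'I_r -> nat) (m : {ffun 'I_r -> 'I_n}) :
  (forall a, (0 < m a)%N) ->
  (1 - zeta) ^- wt k * zterm zeta k (fun a => m a) =
  \prod_(a < r) zfactor (m a) (k a).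
Proof.
move=> m0; rewrite /wt expr_sum -prodfV -big_split /=.
apply: eq_bigr => a _; rewrite /qint.
(* The entry [m a] satisfies [0 < m a < n], which forces [n > 1] and hence [zeta] different from
   1. *)
have z1 : 1 - zeta != 0.
  rewrite subr_eq0 eq_sym -(expr1 zeta) -(prim_order_dvd pz) dvdn1.
  by rewrite neq_ltn (leq_ltn_trans (m0 a) (ltn_ord _)) orbT.
rewrite expr_div_n invf_div mulrCA; congr (_ * _).
by rewrite mulKf ?expf_neq0.
Qed.

(** Exchange the sums over indices and over chains: for a fixed chain, the sum over indices is a
    coefficient of a product of [zseries]. *)
Lemma hgf_chain_series (d : bool) (F : nat -> nat -> nat -> C) :
  (forall k r s, F k r s = \sum_(f in indices k r s)
     \sum_(m : {ffun 'I_r -> 'I_n} | chain d n m)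
        \prod_(a < r) zfactor (m a) (f a)) ->
  hgf F = chain_series n zseries d n.
Proof.
move=> FE; apply: fcoef3P => i j l.
rewrite fcoef3D fcoef3_1 fcoef3_hsum /fcoef3 /=.
have [jl0|r0] := posnP (j + l).
  rewrite jl0 chain_sum0 addr0 -/(fcoef3 _ i j l) fcoef3_1.
  by [].
rewrite FE -/(fcoef3 _ i j l) /chain_sum fcoef3_sum.
have -> : (i == 0%N) && (j == 0%N) && (l == 0%N) = false.
  by move: r0; case: (j) (l) => [|j'] [|l']; rewrite ?andbF.
rewrite add0r.
rewrite exchange_big /=; apply: eq_bigr => m _.
by rewrite fcoef3_prod_weight_series.
Qed.

Lemma Fn_prod : (0 < n)%N ->
  Fn n zeta = \prod_(1 <= m < n) (1 + zseries m).
Proof.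
move=> n0; rewrite -(chain_series_strict zseries_homog n0 (leqnn n)).
apply: hgf_chain_series => k r s; apply: eq_bigr => f _.
rewrite /zbar /zn mulr_sumr; apply: eq_big => [m|m /andP[/forallP m0 _]].
  rewrite /chain andbA [X in _ = _ && X](_ : _ = true) ?andbT //.
  exact/forallP.
exact: zterm_zfactor.
Qed.

Lemma Fnstar_prod : (0 < n)%N ->
  Fnstar n zeta * \prod_(1 <= m < n) (1 - zseries m) = 1.
Proof.
move=> n0; rewrite -[RHS](chain_series_weak zseries_homog n0 (leqnn n)).
congr (_ * _); apply: hgf_chain_series => k r s; apply: eq_bigr => f _.
rewrite /zbarstar /znstar mulr_sumr; apply: eq_big => [m|m /andP[/forallP m0 _]].
  rewrite /chain andbA [X in _ = _ && X](_ : _ = true) ?andbT //.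
  exact/forallP.
exact: zterm_zfactor.
Qed.

(** The parts [k >= 2] form a geometric series in [x] of ratio [t / (1 - t)], with sum
    [t / ((1 - t) (1 - (1 + x) t))]. *)
Lemma zseries_closed m : (0 < m)%N -> (m < n)%N ->
  let t := fps3C (zeta ^+ m) in
  (1 - t) * (1 - (1 + varx C) * t) * zseries m =
  vary C * (1 - (1 + varx C) * t) + varz C * t.
Proof.
move=> m0 mn.
have t1 : 1 - zeta ^+ m != 0.
  by rewrite subr_eq0 eq_sym -(prim_order_dvd pz) gtnNdvd.
rewrite /zseries /weight_series /=.
set u := zeta ^+ m in t1 *.
have g1 : (1 - fps3C u) * fps3C (zfactor m 1) = 1.
  by rewrite -(rmorph1 (@fps3C C)) -rmorphB -rmorphM /= /zfactor mul0n expr0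
    mul1r mulfV // rmorph1.
have gS : (1 - fps3C u) * (1 - (1 + varx C) * fps3C u) *
   fpsC (fpsC (Fps (fun i => zfactor m i.+2))) = fps3C u :> fps3 C.
  have <- : fpsC (fpsC ((1 - fpsC u) * (1 - (1 + fpsX) * fpsC u))) =
    (1 - fps3C u) * (1 - (1 + varx C) * fps3C u) :> fps3 C.
    by rewrite !(rmorphM, rmorphB, rmorphD, rmorph1).
  rewrite -!rmorphM /=; congr (fpsC (fpsC _)).
  (* In this form the factor is linear in [x], so each coefficient of the product involves only two
     terms of the series. *)
  have factor (S : comNzRingType) (a b : S) :
      (1 - a) * (1 - (1 + b) * a) = (1 - a) ^+ 2 - a * (1 - a) * b by ring.
  have -> : (1 - fpsC u) * (1 - (1 + fpsX) * fpsC u) =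
      fpsC ((1 - u) ^+ 2) - fpsC (u * (1 - u)) * fpsX :> fps C.
    by rewrite factor !(rmorphM, rmorphXn, rmorphB, rmorph1).
  apply/fpsP => i; rewrite mulrBl -mulrA fcoefD fcoefN !fcoefCM fcoefXM fcoefC /=.
  case: i => [|i] /=.
    by rewrite mulr0 subr0 /zfactor mul1n mulrCA mulfV ?expf_neq0 // mulr1.
  rewrite /zfactor /= mulSn exprD -/u; apply/eqP; rewrite subr_eq0; apply/eqP.
  rewrite (exprSr _ i.+2); move: (_ ^+ (i.+1 * m)) => v.
  have : (1 - u) ^+ i.+2 != 0 by rewrite expf_neq0.
  move: (_ ^+ i.+2) => c c0; field; exact/andP.
rewrite mulrDr; congr (_ + _).
  transitivity ((1 - fps3C u) * fps3C (zfactor m 1) *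
     (vary C * (1 - (1 + varx C) * fps3C u))); first by ring.
  by rewrite g1 mul1r.
by rewrite mulrCA gS.
Qed.
End GeneratingFunctions.

(** * Rational coefficients *)

Section SubringClosure.
Variables (R : nzRingType) (P : R -> Prop).

Definition is_subring :=
  [/\ P 1, forall a b, P a -> P b -> P (a - b)
    & forall a b, P a -> P b -> P (a * b)].

Hypothesis subP : is_subring.

Lemma subring0 : P 0.
Proof. by case: subP => P1 PB _; rewrite -(subrr 1); apply: PB. Qed.

Lemma subringN a : P a -> P (- a).
Proof. by case: subP => _ PB _ Pa; rewrite -sub0r; apply: PB => //; apply: subring0. Qed.

Lemma subringD a b : P a -> P b -> P (a + b).
Proof.
by case: subP => _ PB _ Pa Pb; rewrite -(opprK b); apply: PB => //; apply: subringN.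
Qed.

Lemma subring_sum I (r : seq I) (Q : pred I) (F : I -> R) :
  (forall i, Q i -> P (F i)) -> P (\sum_(i <- r | Q i) F i).
Proof. by move=> PF; apply: big_ind => //; [apply: subring0|apply: subringD]. Qed.

Lemma subring_exp a n : P a -> P (a ^+ n).
Proof.
case: subP => P1 _ PM Pa; elim: n => [|n IH]; first by rewrite expr0.
by rewrite exprS; apply: PM.
Qed.

Lemma subring_nat n : P n%:R.
Proof.
elim: n => [|n IH]; first exact: subring0.
by rewrite -natr1; apply: subringD => //; case: subP.
Qed.
End SubringClosure.

Lemma subring_lucas_quotient (R : comNzRingType) (P : R -> Prop) A B w n :
  is_subring P -> P A -> P B -> P w -> P (lucas_quotient A B w n).
Proof.
move=> subP PA PB Pw; have [_ _ PM] := subP.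
rewrite /lucas_quotient /form3; do 2![apply: (subring_sum subP) => ? _].
by apply: (PM); [apply: (PM); [apply: (PM)|]|];
  [apply: (subring_nat subP)|apply: (subring_exp subP)..].
Qed.

Section SeriesOverSubring.
Variables (R : idomainType) (P : R -> Prop).
Hypothesis subP : is_subring P.

Definition over (a : fps R) := forall n, P (fcoef a n).

Lemma over_subring : is_subring over.
Proof.
have [P1 PB PM] := subP; split=> [n|a b oa ob n|a b oa ob n].
- by case: n => [|n] //; apply: (subring0 subP).
- exact: PB.
- by rewrite fcoefM; apply: (subring_sum subP) => i _; apply: PM.
Qed.

Lemma overC c : P c -> over (fpsC c).
Proof. by move=> Pc [|n] //; apply: (subring0 subP). Qed.

Lemma overX : over fpsX.
Proof. by move=> n; apply: (subring_nat subP). Qed.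

(** By strong induction: coefficient [n] of [a * b] is [fcoef a n * fcoef b 0] plus terms in earlier
    coefficients of [a]. Cancellation is a hypothesis on the constant coefficient so that the lemma
    can be iterated through the three variables. *)
Lemma over_cancel b : over b ->
  (forall c, P (c * fcoef b 0) -> P c) -> forall a, over (a * b) -> over a.
Proof.
move=> ob can a oab n; elim/ltn_ind: n => n IH; apply: can.
have [_ PB PM] := subP.
have := oab n; rewrite fcoefM big_ord_recr /= subnn => Pn.
rewrite -[X in P X](addKr (\sum_(i < n) fcoef a i * fcoef b (n - i)%N)) addrC.
apply: PB => //; apply: (subring_sum subP) => i _; apply: PM => //.
exact: IH.
Qed.
End SeriesOverSubring.

Section RationalSeries.
Variable C : numFieldType.

Definition rational (c : C) := exists p : rat, c = ratr p.

Lemma rational_subring : is_subring rational.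
Proof.
split=> [|_ _ [p ->] [q ->]|_ _ [p ->] [q ->]].
- by exists 1; rewrite rmorph1.
- by exists (p - q); rewrite rmorphB.
- by exists (p * q); rewrite rmorphM.
Qed.

Lemma rational_cancel b : rational b -> b != 0 ->
  forall c, rational (c * b) -> rational c.
Proof.
move=> [q ->] q0 c [p cp]; exists (p / q); by rewrite fmorph_div /= -cp mulfK.
Qed.

Definition rational3 : fps3 C -> Prop := over (over (over rational)).

Lemma rational3_subring : is_subring rational3.
Proof. by do 3!apply: over_subring; apply: rational_subring. Qed.

Lemma rational3_varx : rational3 (varx C).
Proof.
have s0 := rational_subring; have s1 := over_subring s0; have s2 := over_subring s1.
by apply: (overC s2); apply: (overC s1); apply: overX.
Qed.

Lemma rational3_vary : rational3 (vary C).
Proof.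
have s0 := rational_subring; have s1 := over_subring s0; have s2 := over_subring s1.
by apply: (overC s2); apply: (overX s1).
Qed.

Lemma rational3_varz : rational3 (varz C).
Proof.
have s0 := rational_subring; have s1 := over_subring s0; have s2 := over_subring s1.
exact: (overX s2).
Qed.

Lemma rational3_cancel a b : rational3 b -> fcoef3 b 0 0 0 != 0 ->
  rational3 (a * b) -> rational3 a.
Proof.
move=> rb b0; have s0 := rational_subring; have s1 := over_subring s0.
have s2 := over_subring s1.
apply: (over_cancel s2 rb); apply: (over_cancel s1 (rb 0%N)).
apply: (over_cancel s0 (rb 0%N 0%N)); apply: rational_cancel => //.
exact: (rb 0%N 0%N 0%N).
Qed.
End RationalSeries.

Lemma rational_hgf (C : numFieldType) (G : nat -> nat -> nat -> C) :
  rational3 (hgf G) ->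
  forall k r s, (0 < r)%N -> (s <= r)%N -> (r + s <= k)%N -> rational (G k r s).
Proof.
move=> rG k r s r0 sr rsk; rewrite -(fcoef3_hgf G r0 sr rsk).
exact: (rG s (r - s)%N (k - r - s)%N).
Qed.

(** Each part is at least 1, and at least 2 if it counts towards the height. *)
Lemma indices_bound k r s (f : {ffun 'I_r -> 'I_k.+1}) :
  f \in indices k r s -> (s <= r)%N && (r + s <= k)%N.
Proof.
rewrite inE => /and3P[/forallP f0 /eqP wf /eqP hf].
rewrite -{1}hf /height (leq_trans (max_card _)) ?card_ord //=.
rewrite -wf -hf heightE -{1}(card_ord r) -sum1_card -big_split /=.
by apply: leq_sum => a _; have := f0 a; case: (nat_of_ord (f a)) => [|[|]].
Qed.

(* Only depth 0 and the triples occurring in [hgf] can have a nonzero sum. *)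
Lemma rational_sum_indices (C : numFieldType)
    (Z : forall r, ('I_r -> nat) -> C) :
  (forall k, rational (Z 0%N k)) ->
  rational3 (hgf (fun k r s => \sum_(f in indices k r s) Z r (fun a => f a))) ->
  forall k r s, rational (\sum_(f in indices k r s) Z r (fun a => f a)).
Proof.
move=> Z0 rZ k [|r] s.
  by apply: (subring_sum (rational_subring C)) => f _; apply: Z0.
have [/andP[sr rsk]|nb] := boolP ((s <= r.+1)%N && (r.+1 + s <= k)%N).
  exact: (rational_hgf rZ).
rewrite big1 => [|f /indices_bound]; last by rewrite (negPf nb).
exact: (subring0 (rational_subring C)).
Qed.

(** * Passage to the fraction field *)

Lemma tofrac_inj (D : idomainType) : injective (@FracField.tofrac D).
Proof. by move=> a b /eqP; rewrite -subr_eq0 -rmorphB tofrac_eq0 subr_eq0 => /eqP. Qed.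

Lemma rmorph_lucas_quotient (R S : comNzRingType) (f : {rmorphism R -> S})
    A B w n :
  f (lucas_quotient A B w n) = lucas_quotient (f A) (f B) (f w) n.
Proof.
rewrite /lucas_quotient /form3 rmorph_sum; apply: eq_bigr => a _.
rewrite rmorph_sum; apply: eq_bigr => b _.
by rewrite !rmorphM !rmorphXn rmorph_nat.
Qed.

Lemma tofrac_prim (D : idomainType) n (zeta : D) :
  n.-primitive_root (FracField.tofrac zeta) = n.-primitive_root zeta.
Proof.
rewrite /primitive_root_of_unity; congr (_ && _); apply: eq_forallb => i.
by rewrite !unity_rootE -rmorphXn -(rmorph1 (@FracField.tofrac D)) tofrac_eq.
Qed.

Section UnityRootsIdomain.
Variables (D : idomainType) (n : nat) (zeta : D).
Hypothesis pz : n.+1.-primitive_root zeta.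
Local Notation iota := (@FracField.tofrac D).

Let iota_pz : n.+1.-primitive_root (iota zeta).
Proof. by rewrite tofrac_prim. Qed.

(** The geometric sum replaces [(A ^+ n.+1 - 1) / (A - 1)], so that the identity can be stated
    inside [D]. *)
Lemma prod_denominators (A : D) : A != 0 -> A != 1 ->
  \prod_(1 <= m < n.+1) ((1 - zeta ^+ m) * (1 - A * zeta ^+ m)) =
  n.+1%:R * \sum_(i < n.+1) A ^+ i.
Proof.
move=> A0 A1; apply: tofrac_inj; rewrite rmorph_prod rmorphM rmorph_nat rmorph_sum.
have A1' : iota A - 1 != 0 by rewrite -(rmorph1 iota) -rmorphB tofrac_eq0 subr_eq0.
under eq_bigr => m _ do rewrite rmorphM !rmorphB rmorphM rmorph1 rmorphXn.
rewrite big_split /= (prod_1sub_unity_roots iota_pz).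
have iA1 : iota A != 1 by rewrite -subr_eq0.
rewrite (prod_1subM_unity_roots iota_pz) ?tofrac_eq0 //.
rewrite subrX1 mulrAC divff // mul1r; congr (_ * _).
by apply: eq_bigr => i _; rewrite rmorphXn.
Qed.

Lemma prod_numerators (A B w : D) : A != 0 -> w != 0 ->
  \prod_(1 <= m < n.+1)
    (B - (A + B + w) * zeta ^+ m + A * (zeta ^+ m) ^+ 2) =
  lucas_quotient A B w n.
Proof.
move=> A0 w0; apply: tofrac_inj; rewrite rmorph_prod rmorph_lucas_quotient.
rewrite -(prod_quadratic_lucas_quotient iota_pz) ?tofrac_eq0 //.
apply: eq_bigr => m _.
by rewrite !(rmorphD, rmorphN, rmorphM, rmorphXn).
Qed.
End UnityRootsIdomain.

(** Since [(1 + a) ^+ n.+1 - 1] is [a] times the geometric sum, the prefactor of [Un] loses its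
    [a]. *)
Lemma Un_tofrac (D : idomainType) n (a b c : D) : a != 0 ->
  [pchar {fraction D}] =i pred0 ->
  Un n.+1 (FracField.tofrac a) (FracField.tofrac b) (FracField.tofrac c) =
  FracField.tofrac (lucas_quotient (1 + a) (1 + b) (a * b - c) n) /
  FracField.tofrac (n.+1%:R * \sum_(i < n.+1) (1 + a) ^+ i).
Proof.
move=> a0 ch0; rewrite /Un (mul_lucas_quotient _ _ _ _ ch0).
rewrite rmorph_lucas_quotient !(rmorphD, rmorphN, rmorphM, rmorph1).
rewrite rmorph_nat rmorph_sum /= subrX1 [1 + _ - 1]addrC addKr.
under [in RHS]eq_bigr => i _ do rewrite rmorphXn rmorphD rmorph1 /=.
rewrite mulf_div -[_ * _ * n.+1%:R]mulrA -mulf_div divff ?tofrac_eq0 // mul1r.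
by rewrite [_ * n.+1%:R]mulrC.
Qed.

Definition const_coef (C : idomainType) (a : fps3 C) : C := fcoef3 a 0 0 0.

Fact const_coef_is_additive (C : idomainType) : zmod_morphism (@const_coef C).
Proof. by []. Qed.
Fact const_coef_is_monoid_morphism (C : idomainType) :
  monoid_morphism (@const_coef C).
Proof.
by split=> [|a b]; [exact: fcoef3_1 | rewrite /const_coef fcoef3M !big_ord1].
Qed.
HB.instance Definition _ (C : idomainType) :=
  GRing.isZmodMorphism.Build (fps3 C) C (@const_coef C)
    (@const_coef_is_additive C).
HB.instance Definition _ (C : idomainType) :=
  GRing.isMonoidMorphism.Build (fps3 C) C (@const_coef C)
    (@const_coef_is_monoid_morphism C).

(** * Both generating functions as quotients of explicit series *)

Section Assembly.
Variables (C : numFieldType) (n : nat) (zeta : C).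
Hypothesis pz : n.+1.-primitive_root zeta.

Local Notation x := (varx C).
Local Notation y := (vary C).
Local Notation z := (varz C).
Local Notation iota := (@FracField.tofrac (fps3 C)).

Definition den : fps3 C := n.+1%:R * \sum_(i < n.+1) (1 + x) ^+ i.

Lemma fcoef3_varx i j l :
  fcoef3 x i j l = ((i == 1%N) && (j == 0%N) && (l == 0%N))%:R.
Proof. by rewrite -(fcoef3_monomial C 1 0 0) !expr0 expr1 !mulr1. Qed.

Lemma fcoef3_varxyB : fcoef3 (x * y - z) 0 0 1 = - 1.
Proof.
have xy : fcoef3 (x * y) 0 0 1 = 0.
  by have := fcoef3_monomial C 1 1 0 0 0 1; rewrite expr0 !expr1 mulr1.
have zE : fcoef3 z 0 0 1 = 1.
  by have := fcoef3_monomial C 0 0 1 0 0 1; rewrite !expr0 expr1 !mul1r.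
by rewrite (fcoef3D (x * y) (- z)) (fcoef3N z) xy zE sub0r.
Qed.

Lemma varx_neq0 : x != 0.
Proof.
apply/eqP => /(congr1 (fun a => fcoef3 a 1 0 0)).
by rewrite fcoef3_varx => /eqP; rewrite oner_eq0.
Qed.

Lemma const_coef_addr1_varx : const_coef (1 + x) = 1.
Proof.
have E (a : fps3 C) : const_coef (1 + a) = 1 + const_coef a.
  by rewrite rmorphD; congr (_ + _); apply: rmorph1.
by rewrite E [const_coef x](fcoef3_varx 0 0 0) addr0.
Qed.

Lemma addr1_varx_neq0 : 1 + x != 0.
Proof.
apply: contraTneq (oner_neq0 C) => x1.
by rewrite -const_coef_addr1_varx x1 rmorph0 eqxx.
Qed.

Lemma addr1_varx_neq1 : 1 + x != 1.
Proof. by rewrite -subr_eq0 addrC addKr varx_neq0. Qed.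

Lemma varxyB_neq0 : x * y - z != 0.
Proof.
apply/eqP => /(congr1 (fun a => fcoef3 a 0 0 1)).
by rewrite fcoef3_varxyB => /eqP; rewrite oppr_eq0 oner_eq0.
Qed.

Lemma fps3C_prim : n.+1.-primitive_root (fps3C zeta).
Proof. by rewrite (fmorph_primitive_root (@fps3C C)). Qed.

Lemma fps3C_exp m : fps3C (zeta ^+ m) = fps3C zeta ^+ m.
Proof. exact: (rmorphXn (@fps3C C)). Qed.

Lemma prod_den : \prod_(1 <= m < n.+1)
  ((1 - fps3C zeta ^+ m) * (1 - (1 + x) * fps3C zeta ^+ m)) = den.
Proof. exact: (prod_denominators fps3C_prim addr1_varx_neq0 addr1_varx_neq1). Qed.

(** With [w = a b - c] one has [(1 + a) + (1 + b) + w = 1 + (1 + a) (1 + b) - c], which is the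
    coefficient of [- t] on the left. *)
Lemma numerator_factor (R : comNzRingType) (t a b c s : R) :
  (1 - t) * (1 - (1 + a) * t) * s = b * (1 - (1 + a) * t) + c * t ->
  (1 + s) * ((1 - t) * (1 - (1 + a) * t)) =
  1 + b - (1 + a + (1 + b) + (a * b - c)) * t + (1 + a) * t ^+ 2.
Proof. by move=> E; rewrite mulrDl mul1r [s * _]mulrC E; ring. Qed.

Lemma Fn_den : Fn n.+1 zeta * den = lucas_quotient (1 + x) (1 + y) (x * y - z) n.
Proof.
rewrite (Fn_prod pz) // -prod_den.
rewrite -(prod_numerators fps3C_prim _ addr1_varx_neq0 varxyB_neq0).
rewrite -big_split big_nat_cond [RHS]big_nat_cond; apply: eq_bigr => m.
rewrite andbT => /andP[m0 mn].
by have /numerator_factor := zseries_closed pz m0 mn; rewrite fps3C_exp.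
Qed.

(** [zseries] is linear in [y] and [z], so [1 - zseries m] is [1 + zseries m] with the signs of [y]
    and [z] reversed. *)
Lemma Fnstar_num :
  Fnstar n.+1 zeta * lucas_quotient (1 + x) (1 - y) (x * - y - - z) n = den.
Proof.
have w0 : x * - y - - z != 0 by rewrite mulrN -opprD oppr_eq0 varxyB_neq0.
rewrite -[RHS]mul1r -[X in _ = X * _](Fnstar_prod pz) // -mulrA; congr (_ * _).
rewrite -prod_den.
rewrite -(prod_numerators fps3C_prim _ addr1_varx_neq0 w0).
rewrite -big_split big_nat_cond [RHS]big_nat_cond; apply: eq_bigr => m.
rewrite andbT => /andP[m0 mn].
have := zseries_closed pz m0 mn; rewrite fps3C_exp => E.
by apply/esym/numerator_factor; rewrite mulrN E opprD !mulNr.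
Qed.

Lemma const_coef_den : const_coef den != 0.
Proof.
rewrite rmorphM rmorph_nat rmorph_sum mulf_neq0 ?pnatr_eq0 //=.
rewrite (eq_bigr (fun=> 1)) ?sumr_const ?card_ord ?pnatr_eq0 // => i _.
by rewrite rmorphXn /= const_coef_addr1_varx expr1n.
Qed.

Lemma den_neq0 : den != 0.
Proof. by apply: contra_neq const_coef_den => ->; rewrite rmorph0. Qed.

Lemma fraction_fps3_pchar : [pchar {fraction fps3 C}] =i pred0.
Proof.
move=> p; rewrite -(pchar_num C p).
exact: (fmorph_pchar (iota \o @fps3C C : {rmorphism C -> _})).
Qed.

Lemma Un_den (b c : fps3 C) :
  Un n.+1 (iota x) (iota b) (iota c) =
  iota (lucas_quotient (1 + x) (1 + b) (x * b - c) n) / iota den.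
Proof. exact: (Un_tofrac _ _ _ varx_neq0 fraction_fps3_pchar). Qed.

Lemma Fn_Un : iota (Fn n.+1 zeta) = Un n.+1 (iota x) (iota y) (iota z).
Proof. by rewrite Un_den -Fn_den rmorphM mulfK // tofrac_eq0 den_neq0. Qed.

Lemma Fnstar_Un :
  iota (Fnstar n.+1 zeta) = (Un n.+1 (iota x) (- iota y) (- iota z))^-1.
Proof.
have E := Un_den (- y) (- z); rewrite !rmorphN in E; rewrite {}E invf_div.
(* The quotient is nonzero because it divides [den]. *)
have := den_neq0; rewrite -Fnstar_num mulf_eq0 negb_or => /andP[_ lq0].
by rewrite rmorphM mulfK // tofrac_eq0.
Qed.

Lemma rational3_den : rational3 den.
Proof.
have s := rational3_subring C; have [P1 _ PM] := s.
apply: PM; first exact: (subring_nat s).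
apply: (subring_sum s) => i _; apply: (subring_exp s).
exact: (subringD s P1 (rational3_varx C)).
Qed.

Lemma rational3_Fn : rational3 (Fn n.+1 zeta).
Proof.
have s := rational3_subring C; have [P1 PB PM] := s.
have rx := rational3_varx C; have ry := rational3_vary C.
apply: (rational3_cancel rational3_den const_coef_den); rewrite Fn_den.
apply: (subring_lucas_quotient _ s (subringD s P1 rx) (subringD s P1 ry)).
exact: (PB _ _ (PM _ _ rx ry) (rational3_varz C)).
Qed.

Lemma rational3_Fnstar : rational3 (Fnstar n.+1 zeta).
Proof.
have s := rational3_subring C; have [P1 PB PM] := s.
have rx := rational3_varx C; have ry := rational3_vary C.
have rz := rational3_varz C.
have rq : rational3 (lucas_quotient (1 + x) (1 - y) (x * - y - - z) n).
  apply: (subring_lucas_quotient _ s (subringD s P1 rx) (PB _ _ P1 ry)).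
  exact: (PB _ _ (PM _ _ rx (subringN s ry)) (subringN s rz)).
apply: (rational3_cancel rq); last by rewrite Fnstar_num; apply: rational3_den.
(* The constant term of the quotient divides that of [den], which is nonzero. *)
apply: contra_neq const_coef_den => q0.
by rewrite -Fnstar_num rmorphM [X in _ * X]q0 mulr0.
Qed.
End Assembly.

Theorem theorem1p2 (C : numClosedFieldType) (n : nat) (zeta : C)
    (hn : (1 <= n)%N) (hzeta : n.-primitive_root zeta) :
  (forall k r s : nat,
     (exists p : rat, sum_zbar n zeta k r s = ratr p) /\
     (exists p : rat, sum_zbarstar n zeta k r s = ratr p)) /\
  let x : {fraction fps3 C} := FracField.tofrac (varx C) in
  let y : {fraction fps3 C} := FracField.tofrac (vary C) in
  let z : {fraction fps3 C} := FracField.tofrac (varz C) in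
  FracField.tofrac (Fn n zeta) = Un n x y z /\
  FracField.tofrac (Fnstar n zeta) = (Un n x (- y) (- z))^-1.
Proof.
case: n hn hzeta => // n _ pz; split; last first.
  by split; [apply: Fn_Un | apply: Fnstar_Un].
(* [hgf] does not record depth 0, where every term is an empty product and the sum is an integer. *)
have depth0 (Q : pred {ffun 'I_0 -> 'I_n.+1}) (k : 'I_0 -> nat) :
    rational ((1 - zeta) ^- wt k *
      \sum_(m : {ffun 'I_0 -> 'I_n.+1} | Q m) zterm zeta k (fun i => m i)).
  rewrite /wt big_ord0 expr0 invr1 mul1r.
  apply: (subring_sum (rational_subring C)) => m _; rewrite /zterm big_ord0.
  by case: (rational_subring C).
move=> k r s; split.
- apply: (rational_sum_indices (Z := fun r k => zbar n.+1 zeta k)) => [k'|].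
    exact: depth0.
  exact: rational3_Fn.
- apply: (rational_sum_indices (Z := fun r k => zbarstar n.+1 zeta k)) => [k'|].
    exact: depth0.
  exact: rational3_Fnstar.
Qed.
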